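(* Let $\mathcal{B}$ be an abelian category with enough projective objects and enough injective objects, let $\mathsf{F}:\mathcal{B}\to\mathcal{B}$ be an additive right exact functor with $\mathsf{F}^2=0$, and let $\mathcal{B}\ltimes\mathsf{F}$ be the right trivial extension. Let $(\mathcal{X},\mathcal{Y})$ be a cotorsion pair in $\mathcal{B}$ with $\mathbb{L}_1\mathsf{F}(X)=0$ for all $X\in\mathcal{X}$. If $\mathrm{Ext}^1_{\mathcal{B}}(X,\mathsf{F}(X))=0$ for every $X\in\mathcal{X}$, then $$\Delta(\mathcal{X})^{\perp}=\mathsf{U}^{-1}(\mathcal{Y}),\qquad {}^{\perp}\mathsf{U}^{-1}(\mathcal{Y})=\Delta(\mathcal{X})=\mathsf{T}(\mathcal{X}),$$ and $(\mathsf{T}(\mathcal{X}),\mathsf{U}^{-1}(\mathcal{Y}))$ is a cotorsion pair in $\mathcal{B}\ltimes\mathsf{F}$.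
   Context: The right trivial extension $\mathcal{B}\ltimes\mathsf{F}$ has as objects the pairs $(X,f)$ with $X\in\mathcal{B}$ and $f:\mathsf{F}(X)\to X$ such that $f\circ\mathsf{F}(f)=0$ (automatic when $\mathsf{F}^2=0$); a morphism $(X,f)\to(Y,g)$ is a morphism $\alpha:X\to Y$ in $\mathcal{B}$ with $\alpha\circ f=g\circ\mathsf{F}(\alpha)$. It is an abelian category with exactness computed in $\mathcal{B}$. $\mathbb{L}_1\mathsf{F}$ is the first left derived functor of $\mathsf{F}$. For $X\in\mathcal{B}$, $\mathsf{T}(X)=\left(X\oplus\mathsf{F}(X),\left(\begin{smallmatrix}0&0\\1&0\end{smallmatrix}\right)\right)$, where the matrix is a morphism $\mathsf{F}(X)\oplus\mathsf{F}^2(X)\to X\oplus\mathsf{F}(X)$. $\mathsf{T}(\mathcal{X})$ is the class of objects of $\mathcal{B}\ltimes\mathsf{F}$ isomorphic to $\mathsf{T}(X)$ for some $X\in\mathcal{X}$. $\mathsf{U}^{-1}(\mathcal{Y})=\{(X,f) : X\in\mathcal{Y}\}$. Since $\mathsf{F}^2=0$, $\Delta(\mathcal{X})=\{(X,f) : f \text{ is a monomorphism and } \mathrm{Coker}(f)\in\mathcal{X}\}$. For a class $\mathcal{S}$ of objects in an abelian category $\mathcal{A}$: ${}^{\perp}\mathcal{S}=\{Y : \mathrm{Ext}^1_{\mathcal{A}}(Y,S)=0\ \forall S\in\mathcal{S}\}$ and $\mathcal{S}^{\perp}=\{Y : \mathrm{Ext}^1_{\mathcal{A}}(S,Y)=0\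 \forall S\in\mathcal{S}\}$. A pair $(\mathcal{C},\mathcal{D})$ is a cotorsion pair if $\mathcal{C}={}^{\perp}\mathcal{D}$ and $\mathcal{D}=\mathcal{C}^{\perp}$. *)

(* Defs.v *)
From HB Require Import structures.
From mathcomp Require Import all_boot ssralg.
From mathcomp Require Import boolp classical_sets.

Set Implicit Arguments.
Unset Strict Implicit.
Unset Printing Implicit Defensive.

Import GRing.Theory.
Local Open Scope ring_scope.
Local Open Scope classical_set_scope.

Reserved Notation "g \oc f" (at level 40, left associativity).

(* Preadditive categories. A zmodType carries decidable equality and choice; classically
   every abelian group has such a structure, so this is no restriction. *)
Record preadditive := Preadditive {
  ob :> Type;
  Hom : ob -> ob -> zmodType;
  idm : forall X, Hom X X;
  comp : forall X Y Z, Hom Y Z -> Hom X Y -> Hom X Z;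
  comp_id_l : forall X Y (f : Hom X Y), comp (idm Y) f = f;
  comp_id_r : forall X Y (f : Hom X Y), comp f (idm X) = f;
  compA : forall X Y Z W (h : Hom Z W) (g : Hom Y Z) (f : Hom X Y),
    comp h (comp g f) = comp (comp h g) f;
  compDl : forall X Y Z (g g' : Hom Y Z) (f : Hom X Y),
    comp (g + g') f = comp g f + comp g' f;
  compDr : forall X Y Z (g : Hom Y Z) (f f' : Hom X Y),
    comp g (f + f') = comp g f + comp g f' }.

Arguments Hom {p} X Y.
Arguments idm {p} X.
Arguments comp {p X Y Z} g f.
Notation "g \oc f" := (comp g f).

Section Preadditive.
Variable C : preadditive.
Implicit Types X Y Z W : C.

Lemma comp0l X Y Z (f : Hom X Y) : (0 : Hom Y Z) \oc f = 0.
Proof. by apply: (@addrI _ (0 \oc f)); rewrite -compDl !addr0. Qed.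

Lemma comp0r X Y Z (g : Hom Y Z) : g \oc (0 : Hom X Y) = 0.
Proof. by apply: (@addrI _ (g \oc 0)); rewrite -compDr !addr0. Qed.

Lemma compNl X Y Z (g : Hom Y Z) (f : Hom X Y) : (- g) \oc f = - (g \oc f).
Proof. by apply: (@addrI _ (g \oc f)); rewrite -compDl !subrr comp0l. Qed.

Lemma compNr X Y Z (g : Hom Y Z) (f : Hom X Y) : g \oc (- f) = - (g \oc f).
Proof. by apply: (@addrI _ (g \oc f)); rewrite -compDr !subrr comp0r. Qed.

Definition is_zero Z : Prop :=
  (forall X (f : Hom X Z), f = 0) /\ (forall X (f : Hom Z X), f = 0).

Definition isomorphic X Y : Prop :=
  exists (f : Hom X Y) (g : Hom Y X), g \oc f = idm X /\ f \oc g = idm Y.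

Definition mono X Y (f : Hom X Y) : Prop :=
  forall W (g h : Hom W X), f \oc g = f \oc h -> g = h.

Definition epi X Y (f : Hom X Y) : Prop :=
  forall W (g h : Hom Y W), g \oc f = h \oc f -> g = h.

Definition is_kernel X Y K (f : Hom X Y) (k : Hom K X) : Prop :=
  f \oc k = 0 /\
  forall W (h : Hom W X), f \oc h = 0 -> exists! l : Hom W K, k \oc l = h.

Definition is_cokernel X Y K (f : Hom X Y) (c : Hom Y K) : Prop :=
  c \oc f = 0 /\
  forall W (h : Hom Y W), h \oc f = 0 -> exists! l : Hom K W, l \oc c = h.

Definition projective_ob P : Prop :=
  forall X Y (e : Hom X Y) (f : Hom P Y), epi e -> exists g : Hom P X, e \oc g = f.

Definition injective_ob I : Prop :=
  forall X Y (m : Hom X Y) (f : Hom X I), mono m -> exists g : Hom Y I, g \oc m = f.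

Definition enough_projectives : Prop :=
  forall X, exists (P : C) (p : Hom P X), projective_ob P /\ epi p.

Definition enough_injectives : Prop :=
  forall X, exists (I : C) (i : Hom X I), injective_ob I /\ mono i.

(* Short exact sequences 0 -> S -> E -> Y -> 0. *)
Record extension Y S := Extension {
  ext_ob : C;
  ext_in : Hom S ext_ob;
  ext_pr : Hom ext_ob Y;
  ext_ker : is_kernel ext_pr ext_in;
  ext_coker : is_cokernel ext_in ext_pr }.

(* In an abelian category phi is an isomorphism by the five lemma. *)
Definition ext_equiv Y S (E E' : extension Y S) : Prop :=
  exists phi : Hom (ext_ob E) (ext_ob E'),
    phi \oc ext_in E = ext_in E' /\ ext_pr E' \oc phi = ext_pr E.

Lemma kernel_mono X Y K (f : Hom X Y) (k : Hom K X) : is_kernel f k -> mono k.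
Proof.
move=> [fk kP] W g h e.
have [|l [_ lU]] := kP _ (k \oc g); first by rewrite compA fk comp0l.
by rewrite -(lU g erefl) -(lU h (esym e)).
Qed.

Lemma cokernel_epi X Y K (f : Hom X Y) (c : Hom Y K) : is_cokernel f c -> epi c.
Proof.
move=> [cf cP] W g h e.
have [|l [_ lU]] := cP _ (g \oc c); first by rewrite -compA cf comp0r.
by rewrite -(lU g erefl) -(lU h (esym e)).
Qed.

Lemma mono0 X Y (f : Hom X Y) :
  (forall W (g : Hom W X), f \oc g = 0 -> g = 0) -> mono f.
Proof.
move=> f0 W g h e; apply/eqP; rewrite -subr_eq0; apply/eqP; apply: f0.
by rewrite compDr compNr e subrr.
Qed.

Lemma epi0 X Y (f : Hom X Y) :
  (forall W (g : Hom Y W), g \oc f = 0 -> g = 0) -> epi f.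
Proof.
move=> f0 W g h e; apply/eqP; rewrite -subr_eq0; apply/eqP; apply: f0.
by rewrite compDl compNl e subrr.
Qed.

End Preadditive.

Record abelian := Abelian {
  pa :> preadditive;
  zob : pa;
  zobP : is_zero zob;
  bip : pa -> pa -> pa;
  in1 : forall X Y, Hom X (bip X Y);
  in2 : forall X Y, Hom Y (bip X Y);
  pr1 : forall X Y, Hom (bip X Y) X;
  pr2 : forall X Y, Hom (bip X Y) Y;
  pr1_in1 : forall X Y, pr1 X Y \oc in1 X Y = idm X;
  pr2_in2 : forall X Y, pr2 X Y \oc in2 X Y = idm Y;
  pr1_in2 : forall X Y, pr1 X Y \oc in2 X Y = 0;
  pr2_in1 : forall X Y, pr2 X Y \oc in1 X Y = 0;
  bip_id : forall X Y, in1 X Y \oc pr1 X Y + in2 X Y \oc pr2 X Y = idm (bip X Y);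
  Ker : forall X Y : pa, Hom X Y -> pa;
  ker : forall X Y (f : Hom X Y), Hom (Ker f) X;
  kerP : forall X Y (f : Hom X Y), is_kernel f (ker f);
  Coker : forall X Y : pa, Hom X Y -> pa;
  coker : forall X Y (f : Hom X Y), Hom Y (Coker f);
  cokerP : forall X Y (f : Hom X Y), is_cokernel f (coker f);
  mono_normal : forall X Y (f : Hom X Y), mono f -> is_kernel (coker f) f;
  epi_normal : forall X Y (f : Hom X Y), epi f -> is_cokernel (ker f) f }.

Arguments bip {a} X Y.
Arguments in1 {a} X Y.
Arguments in2 {a} X Y.
Arguments pr1 {a} X Y.
Arguments pr2 {a} X Y.
Arguments Ker {a X Y} f.
Arguments ker {a X Y} f.
Arguments Coker {a X Y} f.
Arguments coker {a X Y} f.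

Section Abelian.
Variable C : abelian.
Implicit Types X Y Z W S : C.

Definition ker_lift X Y W (f : Hom X Y) (h : Hom W X) (e : f \oc h = 0) :
  Hom W (Ker f) := projT1 (cid ((kerP f).2 _ h e)).

Lemma ker_liftE X Y W (f : Hom X Y) (h : Hom W X) (e : f \oc h = 0) :
  ker f \oc ker_lift e = h.
Proof. by rewrite /ker_lift; case: cid => l []. Qed.

(* The homology at Y of X --f--> Y --g--> Z with g f = 0. *)
Definition homology X Y Z (f : Hom X Y) (g : Hom Y Z) (e : g \oc f = 0) : C :=
  Coker (ker_lift e).

Definition exact_seq X Y Z (f : Hom X Y) (g : Hom Y Z) : Prop :=
  exists e : g \oc f = 0, is_zero (homology e).

Lemma split_kernel X Y : is_kernel (pr2 X Y) (in1 X Y).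
Proof.
split=> [|W h e]; first exact: pr2_in1.
exists (pr1 X Y \oc h); split=> [|l <-]; last by rewrite compA pr1_in1 comp_id_l.
rewrite compA -[RHS]comp_id_l -bip_id compDl -[in2 _ _ \oc _ \oc _]compA.
by rewrite e comp0r addr0.
Qed.

Lemma split_cokernel X Y : is_cokernel (in1 X Y) (pr2 X Y).
Proof.
split=> [|W h e]; first exact: pr2_in1.
exists (h \oc in2 X Y); split=> [|l <-].
  rewrite -compA -[RHS]comp_id_r -bip_id compDr [h \oc (in1 _ _ \oc _)]compA.
  by rewrite e comp0l add0r.
by rewrite -compA pr2_in2 comp_id_r.
Qed.

Definition split_extension Y S : extension Y S :=
  Extension (split_kernel S Y) (split_cokernel S Y).

(* Yoneda's Ext^1(Y, S) is the group of equivalence classes of extensions under Baer sum,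
   and its zero is the class of the split extension. *)
Definition Ext1_zero Y S : Prop :=
  forall E : extension Y S, ext_equiv E (split_extension Y S).

Definition lperp (S : set C) : set C := [set Y | forall Z, S Z -> Ext1_zero Y Z].
Definition rperp (S : set C) : set C := [set Y | forall Z, S Z -> Ext1_zero Z Y].

Definition cotorsion_pair (X Y : set C) : Prop := X = lperp Y /\ Y = rperp X.

Record projective_resolution X := ProjectiveResolution {
  res_ob : nat -> C;
  res_d : forall n, Hom (res_ob n.+1) (res_ob n);
  res_aug : Hom (res_ob 0) X;
  res_proj : forall n, projective_ob (res_ob n);
  res_epi : epi res_aug;
  res_exact0 : exact_seq (res_d 0) res_aug;
  res_exact : forall n, exact_seq (res_d n.+1) (res_d n) }.

Lemma exact_ker_epi X Y Z P (g : Hom Y Z) (p : Hom P (Ker g)) :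
  epi p -> exact_seq (ker g \oc p) g.
Proof.
move=> p_epi.
have e : g \oc (ker g \oc p) = 0 by rewrite compA (kerP g).1 comp0l.
exists e; have lp : ker_lift e = p.
  by apply: (kernel_mono (kerP g)); rewrite ker_liftE.
have c0 : coker (ker_lift e) = 0.
  apply: p_epi; rewrite comp0l; apply: etrans (cokerP (ker_lift e)).1.
  exact: (congr1 (comp _) (esym lp)).
have id0 : idm (homology e) = 0.
  by apply: (cokernel_epi (cokerP (ker_lift e))); rewrite comp_id_l comp0l c0.
split=> W f; first by rewrite -[f]comp_id_l id0 comp0l.
by rewrite -[f]comp_id_r id0 comp0r.
Qed.

Lemma exact_mono X Y Z Z' (f : Hom X Y) (g : Hom Y Z) (m : Hom Z Z') :
  mono m -> exact_seq f g -> exact_seq f (m \oc g).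
Proof.
move=> mm [e [z1 z2]].
have e' : m \oc g \oc f = 0 by rewrite -compA e comp0r.
exists e'.
have gk : g \oc ker (m \oc g) = 0.
  by apply: mm; rewrite compA (kerP _).1 comp0r.
pose u := ker_lift gk.
have gk' : m \oc g \oc ker g = 0 by rewrite -compA (kerP _).1 comp0r.
pose v := ker_lift gk'.
have vE : v \oc ker_lift e = ker_lift e'.
  by apply: (kernel_mono (kerP (m \oc g))); rewrite compA !ker_liftE.
have vu : v \oc u = idm _.
  apply: (kernel_mono (kerP (m \oc g))).
  by rewrite compA !ker_liftE comp_id_r.
have c0 : coker (ker_lift e') = 0.
  have h0 : coker (ker_lift e') \oc v \oc ker_lift e = 0.
    by rewrite -compA vE (cokerP _).1.
  have [l [lc _]] := (cokerP (ker_lift e)).2 _ _ h0.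
  by rewrite -[LHS]comp_id_r -vu compA -lc (z2 _ l) !comp0l.
have id0 : idm (homology e') = 0.
  by apply: (cokernel_epi (cokerP (ker_lift e'))); rewrite comp_id_l comp0l c0.
split=> W h; first by rewrite -[h]comp_id_l id0 comp0l.
by rewrite -[h]comp_id_r id0 comp0r.
Qed.

Section StandardResolution.
Hypothesis hP : enough_projectives C.

Definition cover X : C := projT1 (cid (hP X)).
Definition cover_map X : Hom (cover X) X := projT1 (cid (projT2 (cid (hP X)))).

Lemma cover_proj X : projective_ob (cover X).
Proof. exact: (projT2 (cid (projT2 (cid (hP X))))).1. Qed.

Lemma cover_epi X : epi (cover_map X).
Proof. exact: (projT2 (cid (projT2 (cid (hP X))))).2. Qed.

Fixpoint syzygy X n : C :=
  if n is m.+1 then Ker (cover_map (syzygy X m)) else X.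

Definition syzygy_d X n : Hom (cover (syzygy X n.+1)) (cover (syzygy X n)) :=
  ker (cover_map (syzygy X n)) \oc cover_map (syzygy X n.+1).

Lemma syzygy_exact0 X : exact_seq (syzygy_d X 0) (cover_map X).
Proof. exact/exact_ker_epi/cover_epi. Qed.

Lemma syzygy_exact X n : exact_seq (syzygy_d X n.+1) (syzygy_d X n).
Proof.
apply: exact_mono; first exact: kernel_mono (kerP _).
exact/exact_ker_epi/cover_epi.
Qed.

Definition std_resolution X : projective_resolution X :=
  @ProjectiveResolution X (fun n => cover (syzygy X n)) (syzygy_d X) (cover_map X)
    (fun n => @cover_proj (syzygy X n)) (@cover_epi X) (syzygy_exact0 X)
    (syzygy_exact X).

End StandardResolution.

End Abelian.

Record additive_functor (C D : preadditive) := AdditiveFunctor {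
  fob :> C -> D;
  fmap : forall X Y, Hom X Y -> Hom (fob X) (fob Y);
  fmap_id : forall X, fmap (idm X) = idm (fob X);
  fmap_comp : forall X Y Z (g : Hom Y Z) (f : Hom X Y),
    fmap (g \oc f) = fmap g \oc fmap f;
  fmapD : forall X Y (f g : Hom X Y), fmap (f + g) = fmap f + fmap g }.

Arguments fmap {C D} a {X Y} f.

Lemma fmap0 (C D : preadditive) (F : additive_functor C D) (X Y : C) :
  fmap F (0 : Hom X Y) = 0.
Proof. by apply: (@addrI _ (fmap F 0)); rewrite -fmapD !addr0. Qed.

Lemma fmapN (C D : preadditive) (F : additive_functor C D) (X Y : C) (f : Hom X Y) :
  fmap F (- f) = - fmap F f.
Proof. by apply: (@addrI _ (fmap F f)); rewrite -fmapD !subrr fmap0. Qed.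

(* X --f--> Y --c--> Z --> 0 is exact iff c is a cokernel of f. *)
Definition right_exact (C D : abelian) (F : additive_functor C D) : Prop :=
  forall (X Y Z : C) (f : Hom X Y) (c : Hom Y Z),
    is_cokernel f c -> is_cokernel (fmap F f) (fmap F c).

Section LeftDerived.
Variables (C D : abelian) (F : additive_functor C D).

Lemma fmap_complex (X : C) (R : projective_resolution X) n :
  fmap F (res_d R n) \oc fmap F (res_d R n.+1) = 0.
Proof. by have [e _] := res_exact R n; rewrite -fmap_comp e fmap0. Qed.

Definition L1 (hP : enough_projectives C) (X : C) : D :=
  homology (fmap_complex (std_resolution hP X) 0).

End LeftDerived.

Section TrivialExtension.
Variables (B : abelian) (F : additive_functor B B).

Record tobj := TObj {
  U : B;
  str : Hom (F U) U;
  str_sq : str \oc fmap F str = 0 }.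

Definition is_thom (M N : tobj) (a : Hom (U M) (U N)) : bool :=
  a \oc str M == str N \oc fmap F a.

Lemma is_thom_zmod M N : zmod_closed (@is_thom M N).
Proof.
split=> [|a b]; rewrite /is_thom -!topredE /=.
  by rewrite fmap0 comp0l comp0r.
move=> /eqP ea /eqP eb.
by rewrite fmapD fmapN compDl compDr compNl compNr ea eb.
Qed.

HB.instance Definition _ M N :=
  GRing.isZmodClosed.Build _ (@is_thom M N) (@is_thom_zmod M N).

Record thom (M N : tobj) := THom { tmor : Hom (U M) (U N); tmorP : is_thom tmor }.

HB.instance Definition _ M N := [isSub of thom M N for @tmor M N].
HB.instance Definition _ M N := [Choice of thom M N by <:].
HB.instance Definition _ M N := [SubChoice_isSubZmodule of thom M N by <:].

Lemma tmorE M N (a : thom M N) : tmor a \oc str M = str N \oc fmap F (tmor a).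
Proof. exact/eqP/(tmorP a). Qed.

Definition mkthom M N (a : Hom (U M) (U N)) (e : a \oc str M = str N \oc fmap F a) :
  thom M N := THom (introT eqP e).

Lemma tidm_subproof M : idm (U M) \oc str M = str M \oc fmap F (idm (U M)).
Proof. by rewrite fmap_id comp_id_l comp_id_r. Qed.

Lemma tcomp_subproof M N P (b : thom N P) (a : thom M N) :
  tmor b \oc tmor a \oc str M = str P \oc fmap F (tmor b \oc tmor a).
Proof. by rewrite -compA tmorE fmap_comp !compA tmorE. Qed.

Definition tidm M : thom M M := mkthom (tidm_subproof M).
Definition tcomp M N P (b : thom N P) (a : thom M N) : thom M P :=
  mkthom (tcomp_subproof b a).

Lemma thom_eq M N (a b : thom M N) : tmor a = tmor b -> a = b.
Proof. exact: val_inj. Qed.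

Definition triv_preadd : preadditive.
Proof.
refine (@Preadditive tobj (fun M N => thom M N : zmodType) tidm tcomp _ _ _ _ _).
- by move=> M N f; apply: thom_eq; apply: comp_id_l.
- by move=> M N f; apply: thom_eq; apply: comp_id_r.
- by move=> M N P Q h g f; apply: thom_eq; apply: compA.
- by move=> M N P g g' f; apply: thom_eq; apply: compDl.
- by move=> M N P g f f'; apply: thom_eq; apply: compDr.
Defined.

Notation A := triv_preadd.

(* Every limit and colimit below is the one of B, equipped with an induced structure map. *)

Definition tzob : A := @TObj (zob B) 0 (comp0l _ _).

Lemma tzobP : is_zero tzob.
Proof.
by split=> M f; apply: thom_eq; [apply: (zobP B).1 | apply: (zobP B).2].
Qed.

Definition bip_str (M N : A) : Hom (F (bip (U M) (U N))) (bip (U M) (U N)) :=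
  in1 _ _ \oc str M \oc fmap F (pr1 _ _) + in2 _ _ \oc str N \oc fmap F (pr2 _ _).

Lemma pr1_bip_str M N : pr1 _ _ \oc bip_str M N = str M \oc fmap F (pr1 _ _).
Proof.
by rewrite compDr !compA pr1_in1 pr1_in2 !comp0l addr0 comp_id_l.
Qed.

Lemma pr2_bip_str M N : pr2 _ _ \oc bip_str M N = str N \oc fmap F (pr2 _ _).
Proof.
by rewrite compDr !compA pr2_in1 pr2_in2 !comp0l add0r comp_id_l.
Qed.

Lemma bip_str_in1 M N : in1 _ _ \oc str M = bip_str M N \oc fmap F (in1 _ _).
Proof.
rewrite compDl -!(compA _ _ (fmap F (in1 _ _))) -!fmap_comp pr1_in1 pr2_in1.
by rewrite fmap_id fmap0 comp_id_r comp0r addr0.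
Qed.

Lemma bip_str_in2 M N : in2 _ _ \oc str N = bip_str M N \oc fmap F (in2 _ _).
Proof.
rewrite compDl -!(compA _ _ (fmap F (in2 _ _))) -!fmap_comp pr1_in2 pr2_in2.
by rewrite fmap_id fmap0 comp_id_r comp0r add0r.
Qed.

Lemma bip_str_sq M N : bip_str M N \oc fmap F (bip_str M N) = 0.
Proof.
rewrite {1}/bip_str compDl -!(compA _ _ (fmap F (bip_str M N))) -!fmap_comp.
rewrite pr1_bip_str pr2_bip_str !fmap_comp.
by rewrite !compA -!(compA _ (str _) (fmap F (str _))) !str_sq !comp0r !comp0l addr0.
Qed.

Definition tbip M N : A := TObj (bip_str_sq M N).
Definition tin1 M N : Hom (M : A) (tbip M N) := mkthom (N := tbip M N) (bip_str_in1 M N).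
Definition tin2 M N : Hom (N : A) (tbip M N) := mkthom (N := tbip M N) (bip_str_in2 M N).
Definition tpr1 M N : Hom (tbip M N) (M : A) := mkthom (M := tbip M N) (pr1_bip_str M N).
Definition tpr2 M N : Hom (tbip M N) (N : A) := mkthom (M := tbip M N) (pr2_bip_str M N).

Section Kernel.
Variables (M N : A) (a : Hom M N).
Let k := ker (tmor a).

Lemma ker_str_subproof : tmor a \oc (str M \oc fmap F k) = 0.
Proof. by rewrite compA tmorE -compA -fmap_comp (kerP _).1 fmap0 comp0r. Qed.

Definition ker_str : Hom (F (Ker (tmor a))) (Ker (tmor a)) := ker_lift ker_str_subproof.

Lemma ker_strE : k \oc ker_str = str M \oc fmap F k.
Proof. exact: ker_liftE. Qed.

Lemma ker_str_sq : ker_str \oc fmap F ker_str = 0.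
Proof.
apply: (kernel_mono (kerP (tmor a))); rewrite -/k compA ker_strE -compA -fmap_comp.
by rewrite ker_strE fmap_comp compA str_sq comp0l comp0r.
Qed.

Definition tKer : A := TObj ker_str_sq.
Definition tker : Hom tKer M := mkthom (M := tKer) ker_strE.

End Kernel.

Lemma is_kernel_triv (M N K : A) (a : Hom M N) (k : Hom K M) :
  is_kernel (tmor a) (tmor k) -> is_kernel a k.
Proof.
move=> kK; have km := kernel_mono kK; case: kK => ak kP.
split=> [|W h e]; first exact: thom_eq.
have [l [kl _]] := kP _ (tmor h) (congr1 (@tmor _ _) e).
have le : l \oc str W = str K \oc fmap F l.
  by apply: km; rewrite !compA kl !tmorE -compA -fmap_comp kl.
exists (mkthom le); split=> [|l' e']; first exact: thom_eq.
by apply/thom_eq/km; rewrite /= kl -e'.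
Qed.

Lemma tkerP M N (a : Hom (M : A) N) : is_kernel a (tker a).
Proof. exact/is_kernel_triv/kerP. Qed.

Lemma mono_triv (M N : A) (a : Hom M N) : mono a -> mono (tmor a).
Proof.
move=> am; have k0 : tker a = 0 by apply: am; rewrite (tkerP a).1 comp0r.
apply: mono0 => W g /(kerP (tmor a)).2[l [<- _]].
by rewrite (congr1 (@tmor _ _) k0 : ker (tmor a) = 0) comp0l.
Qed.

Hypothesis Fr : right_exact F.

Section Cokernel.
Variables (M N : A) (a : Hom M N).
Let c := coker (tmor a).

Lemma coker_str_subproof : c \oc str N \oc fmap F (tmor a) = 0.
Proof. by rewrite -compA -tmorE compA (cokerP _).1 comp0l. Qed.

Definition coker_str : Hom (F (Coker (tmor a))) (Coker (tmor a)) :=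
  projT1 (cid ((Fr (cokerP (tmor a))).2 _ _ coker_str_subproof)).

Lemma coker_strE : c \oc str N = coker_str \oc fmap F c.
Proof. by rewrite /coker_str; case: cid => l []. Qed.

Lemma coker_str_sq : coker_str \oc fmap F coker_str = 0.
Proof.
apply: (cokernel_epi (Fr (Fr (cokerP (tmor a))))); rewrite -/c -compA -fmap_comp.
by rewrite -coker_strE fmap_comp compA -coker_strE -compA str_sq comp0r comp0l.
Qed.

Definition tCoker : A := TObj coker_str_sq.
Definition tcoker : Hom N tCoker := mkthom (N := tCoker) coker_strE.

End Cokernel.

Lemma is_cokernel_triv (M N K : A) (a : Hom M N) (c : Hom N K) :
  is_cokernel (tmor a) (tmor c) -> is_cokernel a c.
Proof.
move=> cK; have ce := cokernel_epi cK; have Fce := cokernel_epi (Fr cK).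
case: cK => ca cP; split=> [|W h e]; first exact: thom_eq.
have [l [lc _]] := cP _ (tmor h) (congr1 (@tmor _ _) e).
have le : l \oc str K = str W \oc fmap F l.
  by apply: Fce; rewrite -!compA -fmap_comp lc -!tmorE compA lc.
exists (mkthom le); split=> [|l' e']; first exact: thom_eq.
by apply/thom_eq/ce; rewrite /= lc -e'.
Qed.

Lemma tcokerP M N (a : Hom (M : A) N) : is_cokernel a (tcoker a).
Proof. exact/is_cokernel_triv/cokerP. Qed.

Lemma epi_triv (M N : A) (a : Hom M N) : epi a -> epi (tmor a).
Proof.
move=> ae; have c0 : tcoker a = 0 by apply: ae; rewrite (tcokerP a).1 comp0l.
apply: epi0 => W g /(cokerP (tmor a)).2[l [<- _]].
by rewrite (congr1 (@tmor _ _) c0 : coker (tmor a) = 0) comp0r.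
Qed.

Definition triv_ext : abelian.
Proof.
refine (@Abelian A tzob tzobP tbip tin1 tin2 tpr1 tpr2 _ _ _ _ _
  tKer tker tkerP tCoker tcoker tcokerP _ _).
- by move=> M N; apply: thom_eq; apply: pr1_in1.
- by move=> M N; apply: thom_eq; apply: pr2_in2.
- by move=> M N; apply: thom_eq; apply: pr1_in2.
- by move=> M N; apply: thom_eq; apply: pr2_in1.
- by move=> M N; apply: thom_eq; apply: bip_id.
- by move=> M N a /mono_triv/mono_normal; apply: (@is_kernel_triv _ _ _ (tcoker a) a).
- by move=> M N a /epi_triv/epi_normal; apply: (@is_cokernel_triv _ _ _ (tker a) a).
Defined.

(* The matrix (0 0; 1 0) : FX (+) FFX -> X (+) FX after the canonical isomorphism
   F(X (+) FX) -> FX (+) FFX, whose first component is F(pr1). *)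
Definition T_str (X : B) : Hom (F (bip X (F X))) (bip X (F X)) :=
  in2 X (F X) \oc fmap F (pr1 X (F X)).

Lemma T_str_sq X : T_str X \oc fmap F (T_str X) = 0.
Proof. by rewrite -compA -fmap_comp compA pr1_in2 comp0l fmap0 comp0r. Qed.

Definition T (X : B) : triv_ext := TObj (T_str_sq X).

Definition T_class (S : set B) : set triv_ext :=
  [set M | exists X, S X /\ isomorphic M (T X)].

Definition Uinv (S : set B) : set triv_ext := [set M : tobj | S (U M)].

(* This is the usual Delta only when F F = 0. *)
Definition Delta (S : set B) : set triv_ext :=
  [set M : tobj | mono (str M) /\ S (Coker (str M))].

End TrivialExtension.

Arguments T_class {B F} Fr S.
Arguments Uinv {B F} Fr S.
Arguments Delta {B F} Fr S.
Arguments T {B F} Fr X.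

(* Main.v *)
(* T is left adjoint to the forgetful functor U, and one shows
     T(X) <= lperp (Uinv Y) <= Delta(X) <= T(X)  and  rperp T(X) <= Uinv Y.
   - An extension of T X by N splits as soon as in1 : X -> T X lifts to it in B.
   - If M is in lperp (Uinv Y), its cokernel lies in lperp Y by testing against the objects
     (Z, 0). For an embedding j : F M -> I into an injective, the extension I (+) M of M by
     (I, 0) with structure map (j, str M) splits, so j factors through str M, which is
     therefore a monomorphism.
   - If str M is a monomorphism with cokernel c : M -> X, then F c is an isomorphism since
     F F M = 0, so M is an extension of X by F X in B; it splits, and M = T X.
   - If M is in rperp T(X) and 0 -> U M -> E -> X -> 0 is exact in B, then L1 F X = 0 makes
     0 -> T (U M) -> T E -> T X -> 0 exact; the counit T (U M) -> M extends to T E, and this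
     gives a retraction E -> U M. *)
From mathcomp Require Import all_boot ssralg.
From mathcomp Require Import boolp classical_sets.
Require Import Defs.

Set Implicit Arguments.
Unset Strict Implicit.
Unset Printing Implicit Defensive.

Import GRing.Theory.
Local Open Scope ring_scope.
Local Open Scope classical_set_scope.

(* Kernels, monomorphisms, etc. of opp C are convertible to their duals in C, so a lemma
   applied to opp C is a proof of the dual statement. *)
Section Opposite.
Variable C : abelian.

Definition opp_preadd : preadditive.
Proof.
refine (@Preadditive C (fun X Y => Hom Y X) (@idm C) (fun X Y Z g f => f \oc g)
  _ _ _ _ _).
- by move=> X Y f; apply: comp_id_r.
- by move=> X Y f; apply: comp_id_l.
- by move=> X Y Z W h g f; rewrite compA.
- by move=> X Y Z g g' f; apply: compDr.
- by move=> X Y Z g f f'; apply: compDl.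
Defined.

Definition opp : abelian.
Proof.
refine (@Abelian opp_preadd (zob C) _ (fun X Y => bip X Y)
  (fun X Y => pr1 X Y) (fun X Y => pr2 X Y) (fun X Y => in1 X Y) (fun X Y => in2 X Y)
  _ _ _ _ _
  (fun X Y f => Coker (f : @Hom C Y X)) (fun X Y f => coker (f : @Hom C Y X)) _
  (fun X Y f => Ker (f : @Hom C Y X)) (fun X Y f => ker (f : @Hom C Y X)) _ _ _).
- by have [z1 z2] := zobP C; split.
- by move=> X Y; apply: pr1_in1.
- by move=> X Y; apply: pr2_in2.
- by move=> X Y; apply: pr2_in1.
- by move=> X Y; apply: pr1_in2.
- by move=> X Y; apply: bip_id.
- by move=> X Y f; apply: (@cokerP C).
- by move=> X Y f; apply: (@kerP C).
- move=> X Y f mf; apply: (@epi_normal C); exact: mf.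
- move=> X Y f mf; apply: (@mono_normal C); exact: mf.
Defined.

End Opposite.

(** * Pullbacks of epimorphisms and lifting of morphisms *)

Section AbelianCategory.
Variable C : abelian.
Implicit Types X Y Z W S E Q : C.

Lemma epi_comp_eq0 X Y Z (e : Hom X Y) (g : Hom Y Z) : epi e -> g \oc e = 0 -> g = 0.
Proof. by move=> ee e0; apply: ee; rewrite comp0l. Qed.

Lemma mono_comp_eq0 X Y Z (m : Hom Y Z) (g : Hom X Y) : mono m -> m \oc g = 0 -> g = 0.
Proof. by move=> mm e0; apply: mm; rewrite comp0r. Qed.

Lemma bip_eq0 X Y W (g : Hom W (bip X Y)) : pr1 X Y \oc g = 0 -> pr2 X Y \oc g = 0 -> g = 0.
Proof.
move=> e1 e2; rewrite -[g]comp_id_l -bip_id compDl -!compA e1 e2 !comp0r.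
exact: addr0.
Qed.

(** The epimorphism [f] is the cokernel of [ker f], which factors through [k]. *)
Lemma kernel_cokernel X Y K (f : Hom X Y) (k : Hom K X) :
  is_kernel f k -> epi f -> is_cokernel k f.
Proof.
move=> [fk kP] fe; split=> // W h hk.
have [_ fP] := epi_normal fe; apply: fP.
have [l [<- _]] := kP _ _ (kerP f).1.
by rewrite compA hk comp0l.
Qed.

(** The pullback is the kernel of [d]. As [d] is epi, it is the cokernel of that kernel, so a [g]
    killing [f'] yields [l] with [l \oc d = g \oc pr2 E Z]; restriction to [E] gives [l \oc f = 0],
    whence [l = 0]. *)
Lemma pullback_epi E Q Z (f : Hom E Q) (h : Hom Z Q) : epi f ->
  exists P (f' : Hom P Z) (h' : Hom P E),
  [/\ epi f', f \oc h' = h \oc f'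
    & forall W (u : Hom W E) (v : Hom W Z), f \oc u = h \oc v ->
      exists! w, h' \oc w = u /\ f' \oc w = v].
Proof.
move=> fe; pose d := f \oc pr1 E Z - h \oc pr2 E Z.
have d1 : d \oc in1 E Z = f.
  by rewrite compDl compNl -!compA pr1_in1 pr2_in1 comp0r oppr0 addr0 comp_id_r.
have de : epi d.
  by apply: epi0 => W g gd; apply: (epi_comp_eq0 fe); rewrite -d1 compA gd comp0l.
have sq : f \oc (pr1 E Z \oc ker d) = h \oc (pr2 E Z \oc ker d).
  apply/eqP; rewrite -subr_eq0; apply/eqP.
  by have := (kerP d).1; rewrite compDl compNl -!compA.
exists (Ker d), (pr2 E Z \oc ker d), (pr1 E Z \oc ker d); split=> //.
- apply: epi0 => W g; rewrite compA => /(epi_normal de).2[l [le _]].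
  have l0 : l = 0.
    by apply: (epi_comp_eq0 fe); rewrite -d1 compA le -compA pr2_in1 comp0r.
  by rewrite -[g]comp_id_r -(pr2_in2 E Z) compA -le l0 !comp0l.
- move=> W u v e.
  have [|w [we wU]] := (kerP d).2 _ (in1 E Z \oc u + in2 E Z \oc v).
    rewrite compDr !compA d1 compDl compNl -!compA.
    by rewrite pr1_in2 pr2_in2 !comp0r sub0r comp_id_r compNl e subrr.
  exists w; split.
    rewrite -!compA we !compDr !compA pr1_in1 pr2_in2 pr1_in2 pr2_in1.
    by rewrite !comp0l !comp_id_l add0r addr0.
  move=> w' [e1 e2]; apply: wU.
  by rewrite -e1 -e2 -[LHS]comp_id_l -bip_id compDl !compA.
Qed.

(** Pulled back along [h], [p] still has kernel [S], and a section of the pullback gives the lift.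
    The hypothesis is phrased by sections so that the lemma also serves in [opp C]. *)
Lemma section_lift Z S :
  (forall E (i : Hom S E) (p : Hom E Z), is_kernel p i -> epi p ->
     exists s, p \oc s = idm Z) ->
  forall E Q (i : Hom S E) (p : Hom E Q) (h : Hom Z Q), is_kernel p i -> epi p ->
    exists g, p \oc g = h.
Proof.
move=> sec E Q i p h [pi iP] pe.
have im := kernel_mono (conj pi iP).
have [P [p' [h' [p'e sq PP]]]] := pullback_epi h pe.
have [|j [[j1 j2] _]] := PP _ i 0; first by rewrite pi comp0r.
have Puniq W (w w' : Hom W P) :
    h' \oc w = h' \oc w' -> p' \oc w = p' \oc w' -> w = w'.
  move=> e1 e2; have [|v [_ vU]] := PP _ (h' \oc w') (p' \oc w').
    by rewrite !compA sq.
  by rewrite -(vU w (conj e1 e2)) -(vU w' (conj erefl erefl)).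
have jK : is_kernel p' j.
  split=> // W w w0.
  have [|l [le lU]] := iP _ (h' \oc w); first by rewrite compA sq -compA w0 comp0r.
  exists l; split; first by apply: Puniq; rewrite compA ?j1 ?j2 // comp0l w0.
  by move=> l' e; apply: lU; rewrite -e compA j1.
have [s se] := sec _ _ _ jK p'e.
by exists (h' \oc s); rewrite compA sq -compA se comp_id_r.
Qed.

End AbelianCategory.

(** * Vanishing of Ext^1, and diagram chases *)

Section Ext1.
Variable C : abelian.
Implicit Types X Y Z W S E Q : C.

(** Asking for a cokernel and a mono makes this criterion the dual of [Ext1_zero_section]. *)
Lemma Ext1_zero_retraction Y S : Ext1_zero Y S <->
  (forall E (i : Hom S E) (p : Hom E Y), is_cokernel i p -> mono i ->
     exists r, r \oc i = idm S).
Proof.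
split=> [ext0 E i p ip im|retr E].
  have pk : is_kernel p i := @kernel_cokernel (opp C) _ _ _ i p ip im.
  have [phi [/= e1 _]] := ext0 (Extension pk ip).
  by exists (pr1 S Y \oc phi); rewrite -compA e1 pr1_in1.
have [r re] := retr _ _ _ (ext_coker E) (kernel_mono (ext_ker E)).
exists (in1 S Y \oc r + in2 S Y \oc ext_pr E) => /=.
rewrite compDl compDr -!compA re (ext_ker E).1 comp0r addr0 comp_id_r; split=> //.
by rewrite !compA pr2_in1 pr2_in2 comp0l add0r comp_id_l.
Qed.

(** A retraction and a section determine each other by [s \oc p = idm E - i \oc r]. *)
Lemma Ext1_zero_section Y S : Ext1_zero Y S <->
  (forall E (i : Hom S E) (p : Hom E Y), is_kernel p i -> epi p ->
     exists s, p \oc s = idm Y).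
Proof.
rewrite Ext1_zero_retraction; split=> [retr E i p pi pe|sec E i p ip im].
  have ip := kernel_cokernel pi pe.
  have [r re] := retr _ _ _ ip (kernel_mono pi).
  have [|s [se _]] := ip.2 _ (idm E - i \oc r).
    by rewrite compDl compNl -compA re comp_id_l comp_id_r subrr.
  exists s; apply: pe.
  by rewrite -compA se compDr compNr compA pi.1 comp0l subr0 comp_id_l comp_id_r.
have pi : is_kernel p i := @kernel_cokernel (opp C) _ _ _ i p ip im.
have [s se] := sec _ _ _ pi (cokernel_epi ip).
have [|r [re _]] := pi.2 _ (idm E - s \oc p).
  by rewrite compDr compNr compA se comp_id_l comp_id_r subrr.
exists r; apply: im.
by rewrite compA re compDl compNl -compA pi.1 comp0r subr0 comp_id_l comp_id_r.
Qed.

Lemma Ext1_zero_lift Z S : Ext1_zero Z S ->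
  forall E Q (i : Hom S E) (p : Hom E Q) (h : Hom Z Q), is_kernel p i -> epi p ->
    exists g, p \oc g = h.
Proof. by move/Ext1_zero_section/section_lift. Qed.

(** The dual of [Ext1_zero_lift]: in [C], the extension is pushed out along [f]. *)
Lemma Ext1_zero_extend Z S : Ext1_zero Z S ->
  forall A E (i : Hom A E) (p : Hom E Z) (f : Hom A S), is_cokernel i p -> mono i ->
    exists g, g \oc i = f.
Proof.
move=> /Ext1_zero_retraction retr A E i p f ip im.
exact: (@section_lift (opp C) S Z (fun E i p => retr E p i) E A p i f ip im).
Qed.

Lemma Ext1_zero_iso Y Y' S : isomorphic Y Y' -> Ext1_zero Y S -> Ext1_zero Y' S.
Proof.
move=> [f [g [_ fg]]] ext0; apply/Ext1_zero_section => E i p pi pe.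
have [s se] := Ext1_zero_lift ext0 f pi pe.
by exists (s \oc g); rewrite compA se.
Qed.

Lemma isomorphic_sym X Y : isomorphic X Y -> isomorphic Y X.
Proof. by move=> [f [g [gf fg]]]; exists g, f. Qed.

Lemma injective_rperp (S : set C) (I : C) : injective_ob I -> rperp S I.
Proof.
by move=> Iinj Z _; apply/Ext1_zero_retraction => E i p _ im; apply: Iinj.
Qed.

(** If [t] kills [q], then [f] factors through the mono [m \oc n]. The cokernel of [m \oc n] thus
    kills [f], so it factors through [c] and kills [m]; hence [m] factors through [m \oc n], and [n]
    is split epi. *)
Lemma image_epi X Y Z (f : Hom X Y) (c : Hom Y Z) (q : Hom X (Ker c)) :
  is_cokernel f c -> ker c \oc q = f -> epi q.
Proof.
move=> [cf cP] qf; apply: epi0 => W t tq.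
have [q' [q'E _]] := (kerP t).2 _ _ tq.
set n := ker t in q'E; set m := ker c in qf.
have mm : mono m := kernel_mono (kerP c).
have mnm : mono (m \oc n).
  apply: mono0 => V g; rewrite -compA => /(mono_comp_eq0 mm).
  exact: mono_comp_eq0 (kernel_mono (kerP t)).
have [|l [le _]] := cP _ (coker (m \oc n)).
  by rewrite -qf -q'E (compA m) compA (cokerP _).1 comp0l.
have [|w [we _]] := (mono_normal mnm).2 _ m.
  by rewrite -le -compA (kerP c).1 comp0r.
have nw : n \oc w = idm _ by apply: mm; rewrite compA we comp_id_r.
by rewrite -[t]comp_id_r -nw compA (kerP t).1 comp0l.
Qed.

(** Replaces an element chase: the generalized element [y] lifts to [X] after an epi cover of
    [W]. *)
Lemma exact_lift X Y Z W (f : Hom X Y) (c : Hom Y Z) (y : Hom W Y) :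
  is_cokernel f c -> c \oc y = 0 ->
  exists W' (e : Hom W' W) (z : Hom W' X), epi e /\ f \oc z = y \oc e.
Proof.
move=> fc cy.
have [q [qf _]] := (kerP c).2 _ _ fc.1.
have [y' [y'E _]] := (kerP c).2 _ _ cy.
have [P [e [z [ee sq _]]]] := pullback_epi y' (image_epi fc qf).
by exists P, e, z; split=> //; rewrite -qf -compA sq compA y'E.
Qed.

Lemma exact_epi_lift X Y Z (f : Hom X Y) (g : Hom Y Z) :
  exact_seq f g -> forall W (h : Hom Y W), h \oc f = 0 -> h \oc ker g = 0.
Proof.
move=> [e [_ z2]] W h hf.
have [|l [<- _]] := (cokerP (ker_lift e)).2 _ (h \oc ker g).
  by rewrite -compA ker_liftE.
by rewrite (z2 _ l) comp0l.
Qed.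

End Ext1.

(** * Monomorphisms preserved by [F] when [L1] vanishes *)

Section DerivedFunctor.
Variables (C D : abelian) (F : additive_functor C D).
Hypotheses (Fr : right_exact F) (hP : enough_projectives C).

(** Vanishing of [L1] makes [fmap F p1] zero on the kernel of the map from [F P1] to [F P0]. An
    element of [F] of the syzygy that dies in [F P0] lifts, after an epi, along [fmap F p1] into
    that kernel, so it is zero. *)
Lemma L1_zero_syzygy (X : C) :
  is_zero (L1 F hP X) -> mono (fmap F (ker (cover_map hP X))).
Proof.
move=> z; set p1 := cover_map hP (Ker (cover_map hP X)).
set p2 := cover_map hP (Ker p1).
have ex : exact_seq (fmap F (ker p1 \oc p2)) (fmap F (ker (cover_map hP X) \oc p1)).
  by exists (fmap_complex F (std_resolution hP X) 0).
have p1e : epi (fmap F p1).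
  exact: cokernel_epi (Fr (epi_normal (@cover_epi _ hP _))).
have := exact_epi_lift ex (h := fmap F p1).
rewrite fmap_comp compA -fmap_comp (kerP p1).1 fmap0 comp0l => /(_ erefl) p1k.
apply: mono0 => W g ge.
have [P [e [g' [ee sq _]]]] := pullback_epi g p1e.
apply: (epi_comp_eq0 ee); rewrite -sq.
have [|l [<- _]] := (kerP (fmap F (ker (cover_map hP X) \oc p1))).2 _ g'.
  by rewrite fmap_comp -compA sq compA ge comp0l.
by rewrite compA p1k comp0l.
Qed.

(* For 0 -> K -> P -> X -> 0 with P projective, E is the cokernel of a map K -> Y (+) P,
   so an element of Ker(F Y -> F E) comes from Ker(F K -> F P) = L1 F X. *)
Lemma L1_zero_mono (X Y E : C) (i : Hom Y E) (p : Hom E X) :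
  is_kernel p i -> epi p -> is_zero (L1 F hP X) -> mono (fmap F i).
Proof.
move=> pi pe /L1_zero_syzygy Fkm.
have im := kernel_mono pi.
set q := cover_map hP X in Fkm; set k := ker q in Fkm.
have [a ae] := @cover_proj _ hP X _ _ p q pe.
have [|b [be _]] := pi.2 _ (a \oc k); first by rewrite compA ae (kerP q).1.
pose P := cover hP X.
(* The sequence K -> Y (+) P -> E, with maps (b, -k) and (i, a). *)
pose u := in1 Y P \oc b - in2 Y P \oc k.
pose v := i \oc pr1 Y P + a \oc pr2 Y P.
have v1 : v \oc in1 Y P = i.
  by rewrite compDl -!compA pr1_in1 pr2_in1 comp0r addr0 comp_id_r.
have v2 : v \oc in2 Y P = a.
  by rewrite compDl -!compA pr1_in2 pr2_in2 comp0r add0r comp_id_r.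
have uv : is_cokernel u v.
  apply: kernel_cokernel; last first.
    apply: epi0 => W g gv.
    have gi : g \oc i = 0 by rewrite -v1 compA gv comp0l.
    have [l [le _]] := (kernel_cokernel pi pe).2 _ _ gi.
    have l0 : l = 0.
      apply: (epi_comp_eq0 (@cover_epi _ hP X)).
      by rewrite -/q -ae compA le -v2 compA gv comp0l.
    by rewrite -le l0 comp0l.
  split; first by rewrite compDr compNr !compA v1 v2 be subrr.
  move=> W w vw.
  have [|l [le lU]] := (kerP q).2 _ (- (pr2 Y P \oc w)).
    rewrite compNr -ae compA -(compA p).
    have -> : a \oc pr2 Y P = v - i \oc pr1 Y P by rewrite /v addrC addKr.
    by rewrite compDr compNr (compA p i) pi.1 comp0l subr0 -compA vw comp0r oppr0.
  have pr2u : pr2 Y P \oc u = - k.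
    by rewrite compDr compNr !compA pr2_in1 pr2_in2 comp0l comp_id_l sub0r.
  have pr1u : pr1 Y P \oc u = b.
    by rewrite compDr compNr !compA pr1_in1 pr1_in2 comp0l comp_id_l subr0.
  exists l; split=> [|l' e].
    apply/eqP; rewrite -subr_eq0; apply/eqP.
    have e2 : pr2 Y P \oc (u \oc l - w) = 0.
      by rewrite compDr compNr compA pr2u compNl le opprK subrr.
    have e0 : v \oc (u \oc l - w) = 0.
      rewrite compDr compNr vw subr0 compA.
      by rewrite {1}/u compDr compNr !compA v1 v2 be subrr comp0l.
    apply: bip_eq0 => //; apply: (mono_comp_eq0 im).
    by move: e0; rewrite compDl -!compA e2 comp0r addr0.
  by apply: lU; rewrite -e compA pr2u compNl opprK.
(* The element (y, 0) is killed by [fmap F v], so it is locally the image of some [z] under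
   [fmap F u]. Its second component gives [fmap F k \oc z = 0], hence [z = 0]. *)
apply: mono0 => W y yi.
have [|W' [e [z [ee ze]]]] := exact_lift (y := fmap F (in1 Y P) \oc y) (Fr uv).
  by rewrite compA -fmap_comp v1.
have z0 : z = 0.
  apply: (mono_comp_eq0 Fkm).
  have : fmap F (pr2 Y P) \oc (fmap F u \oc z) = 0.
    by rewrite ze !compA -fmap_comp pr2_in1 fmap0 !comp0l.
  rewrite compA -fmap_comp compDr compNr !compA pr2_in1 pr2_in2 comp0l comp_id_l sub0r.
  by rewrite fmapN compNl => /eqP; rewrite oppr_eq0 => /eqP.
apply: (epi_comp_eq0 ee).
have := congr1 (comp (fmap F (pr1 Y P))) ze.
by rewrite z0 !comp0r !compA -fmap_comp pr1_in1 fmap_id comp_id_l.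
Qed.

End DerivedFunctor.

(** * The functor [T] and its adjunction with [U] *)

Section TrivialExtension.
Variables (B : abelian) (F : additive_functor B B).
Hypothesis Fr : right_exact F.
Local Notation A := (triv_ext Fr).
Local Notation T := (T Fr).

(** A test map from [W] in [B] goes to [Ker (tmor a)]; this underlies [tKer a], which the universal
    property of [k] maps to [K]. *)
Lemma tmor_kernel (M N K : A) (a : Hom M N) (k : Hom K M) :
  is_kernel a k -> is_kernel (tmor a) (tmor k).
Proof.
move=> ak; have km : mono (tmor k) := mono_triv (kernel_mono ak).
split=> [|W h e]; first exact: (congr1 (@tmor _ _ _ _) ak.1).
have [l [le _]] := ak.2 _ _ (tkerP a).1.
have [l1 [l1e _]] := (kerP (tmor a)).2 _ _ e.
have e' : tmor k \oc (tmor l \oc l1) = h.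
  by rewrite -l1e compA; congr (_ \oc _); exact: (congr1 (@tmor _ _ _ _) le).
by exists (tmor l \oc l1); split=> // l' e2; apply: km; rewrite e'.
Qed.

Section Adjunction.
Variables (X : B) (M : A).

(** The adjoint transpose of [s]; its component on [F X] is forced by compatibility with the
    structure maps. *)
Definition T_adj_mor (s : Hom X (U M)) : Hom (U (T X)) (U M) :=
  s \oc pr1 X (F X) + str M \oc fmap F s \oc pr2 X (F X).

Lemma T_adj_subproof (s : Hom X (U M)) :
  T_adj_mor s \oc str (T X) = str M \oc fmap F (T_adj_mor s).
Proof.
rewrite fmapD compDr !fmap_comp !compA str_sq !comp0l addr0.
rewrite !compDl -!compA !(compA (pr1 _ _)) !(compA (pr2 _ _)).
by rewrite pr1_in2 pr2_in2 comp0l comp0r add0r comp_id_l.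
Qed.

Definition T_adj (s : Hom X (U M)) : Hom (T X) M := mkthom (T_adj_subproof s).

Lemma T_adj_in1 (s : Hom X (U M)) : tmor (T_adj s) \oc in1 X (F X) = s.
Proof. by rewrite compDl -!compA pr1_in1 pr2_in1 !comp0r addr0 comp_id_r. Qed.

Lemma T_adj_in2 (s : Hom X (U M)) :
  tmor (T_adj s) \oc in2 X (F X) = str M \oc fmap F s.
Proof. by rewrite compDl -!compA pr1_in2 pr2_in2 !comp0r add0r comp_id_r. Qed.

Lemma T_hom_ext (a b : Hom (T X) M) :
  tmor a \oc in1 X (F X) = tmor b \oc in1 X (F X) -> a = b.
Proof.
have str1 : str (T X) \oc fmap F (in1 X (F X)) = in2 X (F X).
  by rewrite -compA -fmap_comp pr1_in1 fmap_id comp_id_r.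
have in2E (c : Hom (T X) M) :
    tmor c \oc in2 X (F X) = str M \oc fmap F (tmor c \oc in1 X (F X)).
  by rewrite -str1 compA tmorE fmap_comp compA.
move=> e; apply: thom_eq.
by rewrite -[tmor a]comp_id_r -[tmor b]comp_id_r -bip_id !compDr !compA !in2E !e.
Qed.

End Adjunction.

Definition T_map (X Y : B) (h : Hom X Y) : Hom (T X) (T Y) :=
  @T_adj X (T Y) (in1 Y (F Y) \oc h).

Lemma T_map_in1 (X Y : B) (h : Hom X Y) :
  tmor (T_map h) \oc in1 X (F X) = in1 Y (F Y) \oc h.
Proof. exact: T_adj_in1. Qed.

(** A left adjoint preserves cokernels: morphisms out of [T Y] are compared through their
    restrictions to [Y]. *)
Lemma T_map_cokernel (X Y Z : B) (f : Hom X Y) (c : Hom Y Z) :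
  is_cokernel f c -> is_cokernel (T_map f) (T_map c).
Proof.
have in1E W V V' (a : Hom W V) (h : Hom (T V) V') :
    tmor (h \oc T_map a) \oc in1 W (F W) = tmor h \oc in1 V (F V) \oc a.
  by rewrite -[RHS]compA -T_map_in1 compA.
move=> fc; split=> [|M h hf].
  apply: T_hom_ext; rewrite in1E T_map_in1.
  by rewrite -compA fc.1 comp0r [tmor 0 \oc _]comp0l.
have [|l [le lU]] := fc.2 _ (tmor h \oc in1 Y (F Y)).
  by rewrite -in1E hf; apply: comp0l.
exists (T_adj l); split=> [|l' e]; apply: T_hom_ext.
  by rewrite in1E T_adj_in1.
by rewrite T_adj_in1; apply: lU; rewrite -in1E e.
Qed.

(** On underlying objects [T_map f] is the diagonal matrix with entries [f] and [fmap F f]. *)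
Lemma T_map_mono (X Y : B) (f : Hom X Y) :
  mono f -> mono (fmap F f) -> mono (T_map f).
Proof.
move=> fm Ffm; apply: mono0 => M g g0.
have {}g0 : tmor (T_map f) \oc tmor g = 0 := congr1 (@tmor _ _ _ _) g0.
have mE : tmor (T_map f) = in1 _ _ \oc (f \oc pr1 _ _) + in2 _ _ \oc (fmap F f \oc pr2 _ _).
  rewrite /= /T_adj_mor /=; congr (_ + _); first by rewrite compA.
  by rewrite -[X in X \oc _]compA -fmap_comp !compA pr1_in1 comp_id_l.
apply: thom_eq; apply: bip_eq0.
  apply: (mono_comp_eq0 fm); have := congr1 (comp (pr1 _ _)) g0.
  by rewrite mE comp0r (compA (pr1 _ _)) compDr !compA pr1_in1 pr1_in2 !comp0l addr0 comp_id_l.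
apply: (mono_comp_eq0 Ffm); have := congr1 (comp (pr2 _ _)) g0.
by rewrite mE comp0r (compA (pr2 _ _)) compDr !compA pr2_in1 pr2_in2 !comp0l add0r comp_id_l.
Qed.

(** * Inclusions between the classes *)

Lemma T_class_lperp (cY : set B) : T_class Fr (lperp cY) `<=` lperp (Uinv Fr cY).
Proof.
move=> M [X [X_perp /isomorphic_sym iso]] N Ny.
apply: (Ext1_zero_iso iso); apply/Ext1_zero_section => E i p pi pe.
have [s se] := Ext1_zero_lift (X_perp _ Ny) (in1 X (F X)) (tmor_kernel pi) (epi_triv Fr pe).
exists (T_adj s); apply: T_hom_ext.
by rewrite -compA T_adj_in1 se comp_id_l.
Qed.

Hypothesis F2 : forall X : B, is_zero (F (F X)).

Definition tobj0 (X : B) : A := @TObj B F X 0 (comp0l _ _).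

Lemma tobj0_map_subproof (X Y : B) (h : Hom X Y) :
  h \oc str (tobj0 X) = str (tobj0 Y) \oc fmap F h.
Proof. by rewrite comp0l comp0r. Qed.

Definition tobj0_map (X Y : B) (h : Hom X Y) : Hom (tobj0 X) (tobj0 Y) :=
  @mkthom B F (tobj0 X) (tobj0 Y) h (tobj0_map_subproof h).

Lemma lperp_Uinv_Delta (cY : set B) : enough_injectives B ->
  (forall I, injective_ob I -> cY I) ->
  lperp (Uinv Fr cY) `<=` Delta Fr (lperp cY).
Proof.
move=> hI injY M M_perp; split; last first.
  move=> Y Yy; apply/Ext1_zero_section => E i p pi pe.
  have c_subproof : coker (str M) \oc str M
      = str (tobj0 (Coker (str M))) \oc fmap F (coker (str M)).
    by rewrite (cokerP _).1 comp0l.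
  pose c' : Hom M (tobj0 (Coker (str M))) :=
    @mkthom B F M (tobj0 (Coker (str M))) _ c_subproof.
  have pi' : is_kernel (tobj0_map p) (tobj0_map i) by apply: is_kernel_triv.
  have pe' : epi (tobj0_map p).
    apply: cokernel_epi (is_cokernel_triv Fr (a := tobj0_map i) _).
    exact: kernel_cokernel pi pe.
  have [h he] := Ext1_zero_lift (M_perp (tobj0 Y) Yy) c' pi' pe'.
  have {}he : p \oc tmor h = coker (str M) := congr1 (@tmor _ _ _ _) he.
  (* A morphism from [M] to an object with zero structure map kills [str M]. *)
  have [|s [se _]] := (cokerP (str M)).2 _ (tmor h).
    by rewrite tmorE comp0l.
  exists s; apply: (cokernel_epi (cokerP (str M))).
  by rewrite -compA se he comp_id_l.
have [I [j [Iinj jm]]] := hI (F (U M)).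
pose e := (in1 I (U M) \oc j + in2 I (U M) \oc str M) \oc fmap F (pr2 I (U M)).
have e_sq : e \oc fmap F e = 0 by apply: (F2 _).2.
pose E : A := TObj e_sq.
have i_subproof : in1 I (U M) \oc str (tobj0 I) = str E \oc fmap F (in1 I (U M)).
  by rewrite comp0r -compA -fmap_comp pr2_in1 fmap0 comp0r.
pose i : Hom (tobj0 I) E := @mkthom B F (tobj0 I) E _ i_subproof.
have p_subproof : pr2 I (U M) \oc str E = str M \oc fmap F (pr2 I (U M)).
  by rewrite compA compDr !compA pr2_in1 pr2_in2 comp0l add0r comp_id_l.
pose p : Hom E M := @mkthom B F E M _ p_subproof.
have pi : is_kernel p i by apply: is_kernel_triv; apply: split_kernel.
have pe : epi p.
  apply: (cokernel_epi (f := i)); apply: is_cokernel_triv => //.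
  exact: split_cokernel.
have [s se] := Ext1_zero_lift (M_perp (tobj0 I) (injY _ Iinj)) (idm M) pi pe.
have {}se : pr2 I (U M) \oc tmor s = idm (U M) := congr1 (@tmor _ _ _ _) se.
(* First component of the compatibility of [s] with the structure maps, using that [s] is a section
   of [p]. *)
have jE : pr1 I (U M) \oc tmor s \oc str M = j.
  rewrite -compA (tmorE s : tmor s \oc str M = e \oc _) -[e \oc _]compA -fmap_comp se fmap_id comp_id_r.
  by rewrite compDr !compA pr1_in1 pr1_in2 comp0l comp_id_l addr0.
by apply: mono0 => W g g0; apply: (mono_comp_eq0 jm); rewrite -jE -compA g0 comp0r.
Qed.

Lemma Delta_T_class (cX : set B) : (forall X, cX X -> Ext1_zero X (F X)) ->
  Delta Fr cX `<=` T_class Fr cX.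
Proof.
move=> hExt M [fm MX]; exists (Coker (str M)); split=> //.
set f := str M in fm MX *; set c := coker f; set X := Coker f in c MX *.
have fc : is_cokernel f c := cokerP f.
(* As [F (F (U M))] is zero, the identity of [F (U M)] kills [fmap F f] and so factors through
   [fmap F c]; thus [l] is a left inverse of [fmap F c]. *)
have [|l [lc _]] := (Fr fc).2 _ (idm _); first by apply: (F2 _).2.
have [g gf] := Ext1_zero_extend (hExt _ MX) (fmap F c) fc fm.
have [r rf] : exists r, r \oc f = idm _ by exists (l \oc g); rewrite -compA gf lc.
have [|s [se _]] := fc.2 _ (idm (U M) - f \oc r).
  by rewrite compDl compNl -compA rf comp_id_l comp_id_r subrr.
have cs : c \oc s = idm X.
  apply: (cokernel_epi fc).
  by rewrite -compA se compDr compNr compA fc.1 comp0l subr0 comp_id_l comp_id_r.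
have rs : r \oc s = 0.
  apply: (epi_comp_eq0 (cokernel_epi fc)).
  by rewrite -compA se compDr compNr compA rf comp_id_l comp_id_r subrr.
have FsFc : fmap F s \oc fmap F c = idm _.
  rewrite -fmap_comp se fmapD fmapN fmap_comp fmap_id.
  by rewrite [fmap F f](F2 _).2 comp0l subr0.
(* The inverse of [T_adj s]: [M] splits through [c] and [r], and [fmap F c] identifies [F (U M)]
   with [F X]. *)
pose psi := in1 X (F X) \oc c + in2 X (F X) \oc (fmap F c \oc r).
have psi_subproof : psi \oc str M = str (T X) \oc fmap F psi.
  have -> : str (T X) \oc fmap F psi = in2 X (F X) \oc fmap F c.
    rewrite -compA -fmap_comp /psi compDr !compA pr1_in1 pr1_in2 !comp0l addr0.
    by rewrite comp_id_l.
  rewrite -/f compDl -!compA rf fc.1 comp0r add0r comp_id_r //.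
exists (@mkthom B F M (T X) _ psi_subproof), (T_adj s); split; last first.
  apply: T_hom_ext; rewrite -compA T_adj_in1 comp_id_l compDl -!compA.
  by rewrite cs rs !comp0r addr0 comp_id_r.
apply: thom_eq; transitivity (tmor (T_adj s) \oc psi) => //.
rewrite /psi compDr 2!(compA (tmor _)) T_adj_in1 T_adj_in2 -/f se.
by rewrite -(compA f) (compA (fmap F s)) FsFc comp_id_l subrK.
Qed.

Lemma rperp_T_class (hP : enough_projectives B) (cX : set B) :
  (forall X, cX X -> is_zero (L1 F hP X)) ->
  rperp (T_class Fr cX) `<=` Uinv Fr (rperp cX).
Proof.
move=> hL M M_perp X Xx; apply/Ext1_zero_retraction => E i p ip im.
have pi : is_kernel p i := @kernel_cokernel (opp B) _ _ _ i p ip im.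
have Fim := L1_zero_mono Fr pi (cokernel_epi ip) (hL _ Xx).
have TX : T_class Fr cX (T X).
  by exists X; split=> //; exists (idm _), (idm _); rewrite comp_id_l.
have [r re] := Ext1_zero_extend (M_perp _ TX) (@T_adj (U M) M (idm _))
  (T_map_cokernel ip) (T_map_mono im Fim).
(* Naturality of [in1] turns the composite with [i] into the counit restricted to [U M], which is
   the identity. *)
exists (tmor r \oc in1 E (F E)).
rewrite -[RHS]T_adj_in1 -re -[in RHS]compA.
by rewrite T_map_in1 compA.
Qed.

End TrivialExtension.

Theorem theorem3p11 (B : abelian) (hP : enough_projectives B) (hI : enough_injectives B)
    (F : additive_functor B B) (hF : right_exact F) (hF2 : forall X : B, is_zero (F (F X)))
    (cX cY : set B) (hXY : cotorsion_pair cX cY)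
    (hL : forall X : B, cX X -> is_zero (L1 F hP X))
    (hExt : forall X : B, cX X -> Ext1_zero X (F X)) :
  [/\ rperp (Delta hF cX) = Uinv hF cY,
      lperp (Uinv hF cY) = Delta hF cX,
      Delta hF cX = T_class hF cX
    & cotorsion_pair (T_class hF cX) (Uinv hF cY)].
Proof.
have [eX eY] := hXY.
(* The next three inclusions form a cycle, so the three classes coincide. *)
have TL : T_class hF cX `<=` lperp (Uinv hF cY) by rewrite eX; apply: T_class_lperp.
have LD : lperp (Uinv hF cY) `<=` Delta hF cX.
  rewrite eX; apply: lperp_Uinv_Delta => // I Iinj.
  by rewrite eY; apply: injective_rperp.
have DT : Delta hF cX `<=` T_class hF cX by apply: Delta_T_class.
have eL : lperp (Uinv hF cY) = Delta hF cX.
  by apply/seteqP; split=> // M /DT/TL.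
have eT : Delta hF cX = T_class hF cX.
  by apply/seteqP; split=> // M /TL/LD.
have eR : rperp (Delta hF cX) = Uinv hF cY.
  apply/seteqP; split.
    by rewrite eT eY; apply: rperp_T_class hL.
  by move=> M My N; rewrite -eL => /(_ _ My).
by split=> //; split; rewrite -?eT.
Qed.
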